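(* Let $T\subset\mathbb{R}^2$ be the closed equilateral triangle with vertices $(0,1)$, $\left(-\tfrac{\sqrt3}{2},-\tfrac12\right)$, $\left(\tfrac{\sqrt3}{2},-\tfrac12\right)$, and let $R\in\mathbb{R}^{2\times 2}$ be the rotation about the origin by angle $\tfrac{2\pi}{3}$. Let $\mathbf{x}$ be a random point of $T$ with probability density $\mathcal{P}(\mathbf{x})=\frac{16|\mathbf{x}|^2}{3\sqrt3}$ on $T$, let $w_1(\mathbf{x})=\frac{\sqrt3}{16|\mathbf{x}|^2}$, and for $f:T\to\mathbb{R}$ define the four-point stochastic quadrature rule $$Q_M(f)=w_1(\mathbf{x})\left(f(\mathbf{x})+f(R\mathbf{x})+f(R^2\mathbf{x})-3f(0)\right)+\frac{3\sqrt3}{4}f(0).$$ Then $Q_M$ is of order $2$ and unbiased on $T$.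
   Context: A stochastic quadrature rule on a bounded domain $\Omega_0\subset\mathbb{R}^d$ is a random functional $Q_M(f)=\sum_{j=1}^J f(\mathbf{x}_j)w_j$, where the points and weights $(\mathbf{x}_j,w_j)_{j=1}^J\in(\Omega_0\times\mathbb{R})^J$ are sampled from a probability measure. The rule is of order $p$ if, with probability $1$, $Q_M(f)=\int_{\Omega_0}f(\mathbf{x})\,d\mathbf{x}$ for every polynomial $f$ of (total) degree at most $p$. The rule is unbiased if $\mathbb{E}(Q_M(f))=\int_{\Omega_0}f(\mathbf{x})\,d\mathbf{x}$ for all integrable (everywhere defined) $f:\Omega_0\to\mathbb{R}$. *)

(* Defs.v *)
From HB Require Import structures.
From mathcomp Require Import all_boot all_order all_algebra.

Set Implicit Arguments.
Unset Strict Implicit.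
Unset Printing Implicit Defensive.

(* A module closed before loading analysis, as the notations clash. *)
Module Poly2.
From mathcomp Require Import mpoly.
Local Open Scope ring_scope.

(* [msize q] is 1 plus the total degree of [q] (and 0 if [q = 0]). *)
Definition degree_le (R : comNzRingType) (n : nat) (q : {mpoly R[2]}) : bool :=
  (msize q <= n.+1)%N.

Definition eval (R : comNzRingType) (q : {mpoly R[2]}) (p : R * R) : R :=
  q.@[fun i : 'I_2 => if i == ord0 then p.1 else p.2].
End Poly2.

From mathcomp Require Import all_classical all_reals all_analysis.
From mathcomp Require Import measurable_realfun.

Import Order.TTheory GRing.Theory Num.Theory.
Import numFieldNormedType.Exports.

Local Open Scope classical_set_scope.
Local Open Scope ring_scope.

Section completed_integrability.
Context d (T : measurableType d) (R : realType).
Variable mu : {measure set T -> \bar R}.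

(* Integrability with respect to the completion of [mu].  With [mu] the
   Lebesgue measure on Borel sets, this is Lebesgue integrability of an
   everywhere defined function; the library's [mu.-integrable] only covers
   the Borel functions.  The library's integral (a supremum over measurable
   simple functions) takes the right value on such functions: see
   [integral_ae_eq] below. *)
Definition completed_integrable (D : set T) (f : T -> \bar R) : Prop :=
  exists2 g : T -> \bar R, mu.-integrable D g & ae_eq mu D f g.

Import HBNNSimple.
Local Open Scope ereal_scope.

Let ge0_le_integral_null (f g : T -> \bar R) (N : set T) :
  measurable N -> mu N = 0 ->
  (forall x, 0 <= f x) -> (forall x, 0 <= g x) ->
  (forall x, ~ N x -> f x = g x) ->
  \int[mu]_x f x <= \int[mu]_x g x.
Proof.
move=> mN N0 f0 g0 fg; rewrite !ge0_integralTE//.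
apply: ge_ereal_sup => _ [h hf <-].
have mNC : measurable (~` N) by exact: measurableC.
have -> : sintegral mu h = sintegral mu (h \_ (~` N)).
  rewrite -integralT_nnsfun -integral_nnsfun// [RHS]integral_mkcond.
  apply: ge0_ae_eq_integral => //.
  - exact/measurable_EFinP.
  - apply/(measurable_restrictT _ mNC).
    by apply/measurable_EFinP; exact: measurable_funTS.
  - by move=> x _; rewrite lee_fin.
  - by move=> x _; rewrite patchE; case: ifP => // _; rewrite lee_fin.
  exists N; split => // x /= /not_implyP[_]; apply: contra_notP => xN.
  by rewrite patchE mem_set.
rewrite (mrestrict h mNC); apply: ereal_sup_ubound.
exists (proj_nnsfun h mNC) => // x; rewrite -(mrestrict h mNC) patchE.
by case: ifPn => // /set_mem xN; rewrite -(fg _ xN).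
Qed.

Lemma integral_ae_eq (D : set T) (f g : T -> \bar R) :
  ae_eq mu D f g -> \int[mu]_(x in D) f x = \int[mu]_(x in D) g x.
Proof.
move=> [N [mN N0 subN]].
have fgN x : ~ N x -> (f \_ D) x = (g \_ D) x.
  move=> xN; rewrite !patchE; case: ifPn => // /set_mem Dx.
  by apply: contrapT => fgx; apply/xN/subN => /= /(_ Dx).
rewrite integral_mkcond [RHS]integral_mkcond integralE [RHS]integralE.
congr (_ - _); apply/eqP; rewrite eq_le; apply/andP; split;
  apply: (ge0_le_integral_null mN) => //;
  by move=> x xN; rewrite ?(funeposE, funenegE) fgN.
Qed.

End completed_integrability.

(* [measurableTypeR R] is [R] with its Borel sets; this is the type on which
   the library's Lebesgue measure lives. *)
Notation plane R := (measurableTypeR R * measurableTypeR R)%type.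

Definition lebesgue2 (R : realType) : {measure set (plane R) -> \bar R} :=
  ((@lebesgue_measure R) \x (@lebesgue_measure R))%E.

Section geometry.
Context (R : realType).
Implicit Types (p a b c : plane R).

(* The norm that the library puts on [R * R] is the sup norm, hence an explicit
   Euclidean one. *)
Definition sqnorm p : R := (p.1 : R) ^+ 2 + (p.2 : R) ^+ 2.

Definition rotation (theta : R) p : plane R :=
  (cos theta * p.1 - sin theta * p.2, sin theta * p.1 + cos theta * p.2).

Definition closed_triangle a b c : set (plane R) :=
  [set p | exists s t u : R, [/\ 0 <= s, 0 <= t, 0 <= u, s + t + u = 1 &
     p = (s * a.1 + t * b.1 + u * c.1, s * a.2 + t * b.2 + u * c.2)]].

End geometry.

Section stochastic_quadrature.
Context d (Omega : measurableType d) (R : realType) (P : probability Omega R).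
Variable D : set (plane R).

(* Functions on [D] are represented by functions on the plane, whose values
   outside [D] play no role as the nodes are in [D]. *)
Definition is_stochastic_quadrature (J : nat)
    (Q : Omega -> (plane R -> R) -> R) : Prop :=
  exists (x : 'I_J -> {RV P >-> plane R}) (w : 'I_J -> {RV P >-> R}),
    (forall j omega, D (x j omega)) /\
    (forall omega f, Q omega f = \sum_(j < J) f (x j omega) * w j omega).

Definition has_order (n : nat) (Q : Omega -> (plane R -> R) -> R) : Prop :=
  {ae P, forall omega, forall q : mpoly.mpoly 2 R, Poly2.degree_le n q ->
    (Q omega (Poly2.eval q))%:E =
      (\int[lebesgue2 R]_(p in D) (Poly2.eval q p)%:E)%E}.

(* The first conclusion says that the expectation exists. *)
Definition unbiased (Q : Omega -> (plane R -> R) -> R) : Prop :=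
  forall f : plane R -> R,
    completed_integrable (lebesgue2 R) D (fun p => (f p)%:E) ->
    completed_integrable P [set: Omega] (fun omega => (Q omega f)%:E) /\
    ('E_P[fun omega => Q omega f] = \int[lebesgue2 R]_(p in D) (f p)%:E)%E.

Definition random_point_with_density (X : {RV P >-> plane R})
    (rho : plane R -> R) : Prop :=
  (forall omega, D (X omega)) /\
  forall A, measurable A ->
    (distribution P X A = \int[lebesgue2 R]_(p in D `&` A) (rho p)%:E)%E.

End stochastic_quadrature.

Section triangle_rule.
Context (R : realType).

Definition triangle : set (plane R) :=
  closed_triangle (0, 1) (- (Num.sqrt 3 / 2), - (1 / 2))
                  (Num.sqrt 3 / 2, - (1 / 2)).

Definition rot120 : plane R -> plane R := rotation (2 * pi / 3).

Definition triangle_density (p : plane R) : R :=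
  16 * sqnorm p / (3 * Num.sqrt 3).

(* As [x / 0 = 0], this is 0 at the origin. *)
Definition w1 (p : plane R) : R := Num.sqrt 3 / (16 * sqnorm p).

Definition four_point_rule (p : plane R) (f : plane R -> R) : R :=
  w1 p * (f p + f (rot120 p) + f (rot120 (rot120 p)) - 3 * f (0, 0))
  + 3 * Num.sqrt 3 / 4 * f (0, 0).

End triangle_rule.

(* Main.v *)
(* Off the origin the product of w1 and the density is the constant 1/3, and
   the triangle and the plane Lebesgue measure are invariant under the rotation
   R by 2 pi / 3 (a product of three shears, each of which preserves the measure
   by Fubini).  So f, f o R and f o R^2 contribute a third of the integral of f
   each, while the terms in f(0) cancel, the area of the triangle being
   3 sqrt 3 / 4: this is unbiasedness.  For f of degree at most 2,
   f + f o R + f o R^2 - 3 f(0) is a multiple of |x|^2, hence the rule takes a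
   constant value off the origin; this value is its expectation, the integral
   of f. *)

Require Import Defs.
From HB Require Import structures.
From mathcomp Require Import all_boot all_order all_algebra.

Set Implicit Arguments.
Unset Strict Implicit.
Unset Printing Implicit Defensive.

(* A module closed before analysis is imported, whose notations clash with
   those of mpoly. *)
Module Poly2Theory.
From mathcomp Require Import mpoly ring.
Import GRing.Theory.
Local Open Scope ring_scope.

(** * Bivariate polynomials of degree at most 2 as explicit quadratics *)

Section quadratic.
Context (R : comNzRingType).

Definition quadratic (c : 'I_6 -> R) (p : R * R) : R :=
  c (inord 0) + c (inord 1) * p.1 + c (inord 2) * p.2
  + c (inord 3) * p.1 ^+ 2 + c (inord 4) * (p.1 * p.2) + c (inord 5) * p.2 ^+ 2.

Lemma quadraticD c c' p :
  quadratic c p + quadratic c' p = quadratic (fun i => c i + c' i) p.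
Proof. by rewrite /quadratic; ring. Qed.

Lemma quadraticZ a c p : a * quadratic c p = quadratic (fun i => a * c i) p.
Proof. by rewrite /quadratic; ring. Qed.

Lemma quadratic_monomial (i j : nat) : (i + j < 3)%N ->
  exists c, forall p : R * R, p.1 ^+ i * p.2 ^+ j = quadratic c p.
Proof.
(* [e k] is the [k]-th unit coefficient vector. The witnesses follow the order of the cases (0,0),
   (0,1), (0,2), (1,0), (1,1), (2,0) for the exponents. *)
pose e (k : nat) (l : 'I_6) : R := ((l == k :> nat))%:R.
have eE k l : (l < 6)%N -> e k (inord l) = (l == k)%:R
  by move=> ?; rewrite /e inordK.
move: i j => [|[|[|i]]] [|[|[|j]]] // _; [exists (e 0%N)|exists (e 2%N)|
  exists (e 5%N)|exists (e 1%N)|exists (e 4%N)|exists (e 3%N)] => p;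
  by rewrite /quadratic !eE//=; ring.
Qed.

(** Every monomial in the support has total degree below 3, hence is quadratic, and quadratics are
    closed under linear combinations. *)
Lemma degree2_quadratic (q : {mpoly R[2]}) : Poly2.degree_le 2 q ->
  exists c, forall p, Poly2.eval q p = quadratic c p.
Proof.
rewrite /Poly2.degree_le => q3.
suff [c cE] : exists c, forall p, \sum_(m <- msupp q) q@_m *
    (p.1 ^+ m ord0 * p.2 ^+ m ord_max) = quadratic c p.
  exists c => p; rewrite -cE /Poly2.eval mevalE; apply: eq_bigr => m _.
  congr (_ * _); rewrite big_ord_recl big_ord1.
  by congr (_ * _ ^+ m _); exact: val_inj.
have : {subset msupp q <= [pred m : 'X_{1..2} | mdeg m < 3]}%N.
  by move=> m /msize_mdeg_lt mq; rewrite inE; exact: leq_trans q3.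
(* The induction runs over the list of monomials alone; the coefficients remain those of [q]. *)
elim: (msupp q : seq _) => [_|m s ih sub].
  by exists (fun=> 0) => p; rewrite big_nil /quadratic; ring.
have [m' m's|c cE] := ih; first by apply: sub; rewrite inE m's orbT.
have /quadratic_monomial[c' c'E] : (m ord0 + m ord_max < 3)%N.
  have := sub m (mem_head _ _); rewrite inE mdegE big_ord_recl big_ord1.
  by congr (_ + m _ < 3)%N; exact: val_inj.
exists (fun i => q@_m * c' i + c i) => p.
by rewrite big_cons cE c'E quadraticZ quadraticD.
Qed.

End quadratic.
End Poly2Theory.

From mathcomp Require Import all_classical all_reals all_analysis.
From mathcomp Require Import measurable_realfun ring lra.

Import Order.TTheory GRing.Theory Num.Theory.
Import numFieldNormedType.Exports.

Local Open Scope classical_set_scope.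
Local Open Scope ring_scope.

(** * Measure-preserving maps and change of variables *)

Lemma measurable_preimage d1 d2 (T1 : measurableType d1) (T2 : measurableType d2)
    (phi : T1 -> T2) (A : set T2) :
  measurable_fun setT phi -> measurable A -> measurable (phi @^-1` A).
Proof. by move=> mphi mA; rewrite -[X in measurable X]setTI; exact: mphi. Qed.

Definition measure_preserving d (T : measurableType d) (R : realType)
    (mu : {measure set T -> \bar R}) (phi : T -> T) :=
  measurable_fun setT phi /\ forall A, measurable A -> mu (phi @^-1` A) = mu A.

Section measure_preserving.
Context d (T : measurableType d) (R : realType).
Variable mu : {measure set T -> \bar R}.
Implicit Types phi psi : T -> T.

Lemma measure_preserving_comp phi psi : measure_preserving mu phi ->
  measure_preserving mu psi -> measure_preserving mu (phi \o psi).
Proof.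
move=> [mphi phiE] [mpsi psiE]; split; first exact: measurableT_comp.
move=> A mA; rewrite comp_preimage psiE ?phiE//.
exact: measurable_preimage.
Qed.

(** The pushforward of [mu] by [phi] is [mu] itself, so this is the change of variables for
    pushforwards. *)
Lemma ge0_integral_measure_preserving phi (D : set T) (f : T -> \bar R) :
  measure_preserving mu phi -> measurable D -> measurable_fun D f ->
  (forall x, 0 <= f x)%E ->
  (\int[mu]_(x in phi @^-1` D) f (phi x) = \int[mu]_(x in D) f x)%E.
Proof.
move=> [mphi phiE] mD mf f0.
rewrite -(@ge0_integral_pushforward _ _ _ _ _ phi mphi mu D f)//.
by apply: eq_measure_integral => A mA _; rewrite -phiE.
Qed.

Lemma integrable_measure_preserving phi (D : set T) (f : T -> \bar R) :
  measure_preserving mu phi -> measurable D -> mu.-integrable D f ->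
  mu.-integrable (phi @^-1` D) (f \o phi).
Proof.
move=> pphi mD /integrableP[mf intf]; apply/integrableP; split.
  apply: (measurable_comp mD) => // [_ [x ? <-]//|].
  by apply: measurable_funTS; case: pphi.
rewrite (ge0_integral_measure_preserving (f := fun x => `|f x|%E))//.
exact: measurableT_comp.
Qed.

Lemma integral_measure_preserving phi (D : set T) (f : T -> \bar R) :
  measure_preserving mu phi -> measurable D -> measurable_fun D f ->
  (\int[mu]_(x in phi @^-1` D) f (phi x) = \int[mu]_(x in D) f x)%E.
Proof.
move=> pphi mD mf; rewrite integralE [RHS]integralE.
rewrite -/(f \o phi) funepos_comp funeneg_comp; congr (_ - _)%E.
  apply: (ge0_integral_measure_preserving (f := f^\+)%E) => //.
  exact: measurable_funepos.
apply: (ge0_integral_measure_preserving (f := f^\-)%E) => //.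
exact: measurable_funeneg.
Qed.

End measure_preserving.

(** * Invariance of Lebesgue measure under translations, the swap and shears *)

Section lebesgue2_invariance.
Context (R : realType).
Local Notation mu := (@lebesgue_measure R).

Lemma measurable_translation (a : R) :
  measurable_fun [set: measurableTypeR R]
    (fun x : measurableTypeR R => (x + a : measurableTypeR R)).
Proof. exact: measurable_funD. Qed.

(** The pushforward gives half-open intervals their length, and this determines Lebesgue measure. *)
Lemma lebesgue_measure_translation (a : R) : measure_preserving mu (fun x => x + a).
Proof.
split; first exact: measurable_translation.
move=> A mA.
(* Bundling the map with its measurability makes its pushforward a measure, as the uniqueness
   theorem requires. *)
pose mixin := isMeasurableFun.Build _ _ _ _ _ (measurable_translation a).
pose phi : {mfun _ >-> _} := HB.pack (fun x : measurableTypeR R =>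
  (x + a : measurableTypeR R)) mixin.
apply/esym.
apply: (lebesgue_measure_unique (mu := pushforward mu phi)) => // _ [[u v] /= uv <-].
rewrite /pushforward /=.
have -> : (fun x => x + a) @^-1` `]u, v] = `]u - a, v - a]%classic.
  by apply/seteqP; split=> x /=; rewrite !in_itv/= ltrBlDr lerBrDr.
rewrite !lebesgue_measure_itv/= !lte_fin ltrD2r.
by case: ifP => // _; rewrite -!EFinB; congr EFin; ring.
Qed.

(** The pushforward agrees with the product measure on rectangles, which determine it. *)
Lemma lebesgue2_swap : measure_preserving (lebesgue2 R) (fun p => (p.2, p.1)).
Proof.
have msw : measurable_fun [set: plane R] (fun p => (p.2, p.1) : plane R).
  by apply/measurable_fun_pairP; split; [exact: measurable_snd|exact: measurable_fst].
split => // A mA.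
pose mixin := isMeasurableFun.Build _ _ _ _ _ msw.
pose phi : {mfun _ >-> _} := HB.pack (fun p : plane R => (p.2, p.1) : plane R) mixin.
apply/esym.
apply: (product_measure_unique (m' := pushforward (lebesgue2 R) phi)) => //.
move=> B C mB mC; rewrite /pushforward/=.
transitivity (lebesgue2 R (C `*` B)).
  by congr (lebesgue2 R _); apply/seteqP; split=> -[x y] [].
by rewrite /lebesgue2/= product_measure1E// muleC.
Qed.

Definition yshear (a : R) (p : plane R) : plane R := (p.1, p.2 + a * p.1).
Definition xshear (a : R) (p : plane R) : plane R := (p.1 + a * p.2, p.2).

(** On the vertical line at abscissa [x] the shear is the translation by [a * x], so preimage
    sections have the same length, and the product measure integrates these lengths. *)
Lemma lebesgue2_yshear a : measure_preserving (lebesgue2 R) (yshear a).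
Proof.
have ms : measurable_fun setT (yshear a).
  apply/measurable_fun_pairP; split; first exact: measurable_fst.
  apply: (@measurable_funD _ _ _ _ snd (fun p : plane R => a * p.1)).
    exact: measurable_snd.
  by apply: (@measurable_funM _ _ _ _ (cst a) fst) => //; exact: measurable_fst.
split => // A mA; rewrite /lebesgue2/= /product_measure1.
apply: eq_integral => x _ /=.
have [_ muA] := lebesgue_measure_translation (a * x).
rewrite -(muA _ (measurable_xsection x mA)).
by congr mu; apply/seteqP; split=> y; rewrite /xsection/= !inE.
Qed.

Lemma lebesgue2_xshear a : measure_preserving (lebesgue2 R) (xshear a).
Proof.
rewrite (_ : xshear a =
  (fun p => (p.2, p.1)) \o (yshear a \o (fun p => (p.2, p.1)))) //.
apply: measure_preserving_comp; first exact: lebesgue2_swap.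
exact: (measure_preserving_comp (lebesgue2_yshear a) lebesgue2_swap).
Qed.

End lebesgue2_invariance.

(** * The rotation and the geometry of the triangle *)

Section triangle.
Context (R : realType).
Local Notation mu2 := (lebesgue2 R).
Local Notation sqrt3 := (Num.sqrt 3 : R).

Lemma sqrt3_gt0 : 0 < sqrt3. Proof. by rewrite sqrtr_gt0. Qed.

Lemma sqr_sqrt3 : sqrt3 * sqrt3 = 3.
Proof. by rewrite -expr2 sqr_sqrtr. Qed.

(** Triple angle formulas: as [3a] is a full turn, [sin (3a) = s (4c^2 - 1) = 0] with [s > 0] forces
    [c^2 = 1/4]; then [cos (3a) = c^3 - 3 c s^2 = -2c = 1] fixes the sign of [c]. *)
Lemma cos_sin_120 :
  cos (2 * pi / 3 : R) = - (1 / 2) /\ sin (2 * pi / 3 : R) = sqrt3 / 2.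
Proof.
set a : R := 2 * pi / 3; have pi0 := pi_gt0 R.
have s0 : 0 < sin a by rewrite sin_gt0_pi// /a; apply/andP; split; lra.
have cs : cos a * cos a + sin a * sin a = 1 by rewrite -!expr2 cos2Dsin2.
have sin3a : sin (a + a + a) = 0.
  have -> : a + a + a = pi + pi by rewrite /a; field.
  by rewrite sinDpi sinpi oppr0.
rewrite !sinD cosD in sin3a.
have cos3a : cos (a + a + a) = 1.
  have -> : a + a + a = pi + pi by rewrite /a; field.
  by rewrite cosDpi cospi opprK.
rewrite !cosD sinD in cos3a.
move: s0 cs sin3a cos3a; move: (cos a) (sin a) => c s s0 cs s3 c3.
have cE : c = - (1 / 2).
  have c4 : (2 * c) ^+ 2 = 1.
    have /eqP : s * ((2 * c) ^+ 2 - 1) = 0.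
      by rewrite -[RHS]s3 -[X in _ - X]cs; ring.
    by rewrite mulf_eq0 gt_eqF//= subr_eq0 => /eqP.
  have c4' : c * c * 4 = 1 by rewrite -[RHS]c4; ring.
  have ss : s * s = 3 / 4 by lra.
  have : c * (c * c) - 3 * c * (s * s) = 1 by rewrite -[RHS]c3; ring.
  rewrite ss.
  have -> : c * c = 1 / 4 by lra.
  by lra.
split=> //; rewrite -[s]ger0_norm ?ltW// -sqrtr_sqr.
have -> : s ^+ 2 = 3 / 4 by rewrite cE in cs; rewrite expr2; lra.
rewrite -[RHS]ger0_norm; last by rewrite divr_ge0 ?ltW ?sqrt3_gt0.
rewrite -sqrtr_sqr; congr Num.sqrt.
by rewrite expr2 mulrACA sqr_sqrt3; lra.
Qed.

Lemma rot120E (p : plane R) :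
  rot120 p = (- (1 / 2) * p.1 - sqrt3 / 2 * p.2, sqrt3 / 2 * p.1 - 1 / 2 * p.2).
Proof. by rewrite /rot120 /rotation; have [-> ->] := cos_sin_120; rewrite !mulNr. Qed.

Lemma rot120K (p : plane R) : rot120 (rot120 (rot120 p)) = p.
Proof.
case: p => x y; rewrite !rot120E/=; have s3 := sqr_sqrt3.
by congr (_, _); field: s3.
Qed.

Lemma rot120_0 : rot120 (0, 0) = (0, 0) :> plane R.
Proof. by rewrite rot120E/= !mulr0 subr0. Qed.

Lemma sqnorm_eq0 (p : plane R) : sqnorm p = 0 -> p = (0, 0).
Proof.
case: p => x y /eqP; rewrite /sqnorm/= paddr_eq0 ?sqr_ge0// !sqrf_eq0.
by move=> /andP[/eqP -> /eqP ->].
Qed.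

Lemma sqnorm_ge0 (p : plane R) : 0 <= sqnorm p.
Proof. by rewrite addr_ge0// sqr_ge0. Qed.

Lemma lebesgue2_rot120 : measure_preserving mu2 (@rot120 R).
Proof.
(* A rotation by [theta] is a product of shears with coefficients [- tan (theta / 2)], [sin theta],
   [- tan (theta / 2)]; here the tangent is [sqrt3] and the sine is [sqrt3 / 2]. *)
have -> : @rot120 R = xshear (- sqrt3) \o (yshear (sqrt3 / 2) \o xshear (- sqrt3)).
  apply/funext => -[x y]; rewrite rot120E /xshear /yshear/=.
  by have s3 := sqr_sqrt3; congr (_, _); field: s3.
apply: measure_preserving_comp; first exact: lebesgue2_xshear.
by apply: measure_preserving_comp; [exact: lebesgue2_yshear|exact: lebesgue2_xshear].
Qed.

Lemma measurable_rot120 : measurable_fun setT (@rot120 R).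
Proof. by case: lebesgue2_rot120. Qed.

(** The description by half-planes makes measurability, sections and bounds accessible. *)
Lemma triangleP (p : plane R) : triangle p <->
  [/\ - (1 / 2) <= p.2, sqrt3 * p.1 <= 1 - p.2 & - (sqrt3 * p.1) <= 1 - p.2].
Proof.
have s0 := sqrt3_gt0; have s3 := sqr_sqrt3; case: p => x y /=; split.
  move=> [s [t [u [? ? ? stu [-> ->]]]]] /=.
  have s3u : sqrt3 * (sqrt3 * u) = 3 * u by rewrite mulrA s3.
  have s3t : sqrt3 * (sqrt3 * t) = 3 * t by rewrite mulrA s3.
  by split; nra.
move=> [h1 h2 h3].
(* Barycentric coordinates: the distances to the three sides divided by the altitude [3 / 2]. *)
exists ((2 * y + 1) / 3), ((1 - y - sqrt3 * x) / 3), ((1 - y + sqrt3 * x) / 3).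
have s3x : sqrt3 * (sqrt3 * x) = 3 * x by rewrite mulrA s3.
split; [lra|lra|lra|by field|].
by rewrite /=; congr (_, _); field: s3.
Qed.

Lemma triangle_rot120 (p : plane R) : triangle p -> triangle (rot120 p).
Proof.
have s3 := sqr_sqrt3.
case: p => _ _ [s [t [u [s0 t0 u0 stu [-> ->]]]]].
(* The rotation permutes the vertices cyclically, hence also the barycentric coordinates. *)
exists u, s, t; split=> //; first by rewrite -stu; ring.
by rewrite rot120E/=; congr (_, _); field: s3.
Qed.

Lemma preimage_rot120_triangle : @rot120 R @^-1` (@triangle R) = @triangle R.
Proof.
apply/seteqP; split=> p; last exact: triangle_rot120.
(* As the rotation has order 3, two further rotations bring [rot120 p] back to [p]. *)
by move=> /= /triangle_rot120/triangle_rot120; rewrite rot120K.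
Qed.

Lemma triangle0 : triangle ((0, 0) : plane R).
Proof. by apply/triangleP; rewrite /= mulr0; split; lra. Qed.

End triangle.

(** * Measurability and area of the triangle *)

Section triangle_area.
Context (R : realType).
Local Notation mu2 := (lebesgue2 R).
Local Notation sqrt3 := (Num.sqrt 3 : R).

Lemma measurable_affine (a b c : R) :
  measurable_fun setT (fun p : plane R => a + b * p.1 + c * p.2 : R).
Proof.
have mb : measurable_fun setT (fun p : plane R => b * p.1 : R).
  by apply: (@measurable_funM _ _ _ _ (cst b) fst) => //; exact: measurable_fst.
have mc : measurable_fun setT (fun p : plane R => c * p.2 : R).
  by apply: (@measurable_funM _ _ _ _ (cst c) snd) => //; exact: measurable_snd.
apply: (measurable_funD _ mc).
exact: (measurable_funD (measurable_cst a) mb).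
Qed.

Lemma measurable_triangle : measurable (@triangle R).
Proof.
pose h (a b c : R) := (fun p : plane R => a + b * p.1 + c * p.2 : R) @^-1` `[0, +oo[.
have mh a b c : measurable (h a b c).
  by apply: measurable_preimage => //; exact: measurable_affine.
rewrite (_ : @triangle R =
  h (1 / 2) 0 1 `&` (h 1 (- sqrt3) (- 1) `&` h 1 sqrt3 (- 1))).
  by apply: measurableI => //; exact: measurableI.
apply/seteqP; split=> -[x y]; rewrite /h /= !in_itv/= !andbT.
  by move/triangleP => [/= ? ? ?]; split; [|split]; lra.
by move=> [? [? ?]]; apply/triangleP; split => /=; lra.
Qed.

(** After the swap the sections are horizontal. Their length is affine over the whole range of
    heights, whereas vertical sections would require a case split at the axis. *)
Lemma triangle_section (y : R) :
  lebesgue_measure (xsection ((fun p : plane R => (p.2, p.1)) @^-1` (@triangle R)) y)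
  = (((fun y : R => 2 * (1 - y) / sqrt3) \_ `[- (1 / 2), 1]) y)%:E.
Proof.
have s0 := sqrt3_gt0 R.
(* For [y > 1] the endpoints come in reverse order and the interval is empty, so only the lower
   bound on [y] is tested. *)
have -> : xsection ((fun p : plane R => (p.2, p.1)) @^-1` (@triangle R)) y =
    if - (1 / 2) <= y then `[- (1 - y) / sqrt3, (1 - y) / sqrt3]%classic else set0.
  apply/seteqP; split=> x; rewrite /xsection/= inE/=.
    move=> /triangleP[/= -> h1 h2].
    rewrite /= in_itv/= ler_pdivrMr// ler_pdivlMr//; apply/andP; split; lra.
  case: ifPn => // y0; rewrite /= in_itv/= ler_pdivrMr// ler_pdivlMr// => /andP[h1 h2].
  by apply/triangleP; split => //=; lra.
rewrite patchE mem_setE in_itv/=; case: ifP => y0 /=; last by rewrite measure0.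
rewrite lebesgue_measure_itv/= lte_fin ltr_pM2r ?invr_gt0//.
case: (leP y 1) => y1; case: ifPn => h //.
- by rewrite -EFinB; congr EFin; ring.
- rewrite -leNgt in h; have -> : y = 1 by lra.
  by rewrite subrr mulr0 mul0r.
- by exfalso; lra.
Qed.

Lemma area_triangle : mu2 (@triangle R) = (3 * sqrt3 / 4)%:E.
Proof.
have s0 := sqrt3_gt0 R; have s3 := sqr_sqrt3 R.
have [_ swapE] := lebesgue2_swap R.
rewrite -(swapE _ measurable_triangle).
rewrite /lebesgue2/= /product_measure1.
under eq_integral => y _ do rewrite /= triangle_section.
rewrite (_ : (fun y => _) = EFin \o
    ((fun y : R => 2 * (1 - y) / sqrt3) \_ `[- (1 / 2), 1])) //.
rewrite -restrict_EFin -integral_mkcond.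
have dF (x : R) : is_derive x 1 (fun y : R => (2 * y - y ^+ 2) / sqrt3)
    (2 * (1 - x) / sqrt3).
  apply: is_derive_eq; rewrite /GRing.scale/=; by field.
(* This second derivative serves only to show that the integrand is continuous. *)
have df (x : R) : is_derive x 1 (fun y : R => 2 * (1 - y) / sqrt3)
    (- (2 / sqrt3)).
  apply: is_derive_eq; rewrite /GRing.scale/=; by field.
have derC (f g : R -> R) : (forall x : R, is_derive x (1 : R) f (g x)) -> continuous f.
  move=> fg x; apply/differentiable_continuous/derivable1_diffP.
  by case: (fg x).
rewrite (continuous_FTC2 (F := fun y => (2 * y - y ^+ 2) / sqrt3)).
(* The primitive increases by [(9 / 4) / sqrt3 = 3 * sqrt3 / 4] from [- (1 / 2)] to [1]. *)
- rewrite -EFinB; congr EFin.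
  by apply: (mulIf (lt0r_neq0 s0)); rewrite mulrBl !divfK ?gt_eqF//; field: s3.
- by lra.
- by apply: continuous_subspaceT; apply: derC df.
- split; first by move=> x _; case: (dF x).
    by apply: cvg_at_right_filter; apply: derC dF _.
  by apply: cvg_at_left_filter; apply: derC dF _.
- by move=> x _; rewrite derive1E; case: (dF x).
Qed.
End triangle_area.

(** * Integration against a measure given by a density *)

Section density.
Context d (T : measurableType d) (R : realType).
Variables (mu P : {measure set T -> \bar R}).
Variables (D : set T) (rho : T -> R).
Hypotheses (mD : measurable D) (mrho : measurable_fun setT rho).
Hypothesis rho_ge0 : forall x, 0 <= rho x.
Hypothesis P_rho : forall A, measurable A ->
  (P A = \int[mu]_(x in D `&` A) (rho x)%:E)%E.

Import HBNNSimple.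

(** For the indicator of a measurable set this is the hypothesis [P_rho]; a simple function is a
    finite combination of indicators of its level sets. *)
Let integral_density_nnsfun (f : {nnsfun T >-> R}) :
  (\int[P]_x (f x)%:E = \int[mu]_(x in D) (f x * rho x)%:E)%E.
Proof.
under [LHS]eq_integral do rewrite fimfunE -fsumEFin//.
rewrite [LHS]ge0_integral_fsum//; last 2 first.
  - by move=> r; exact/measurable_EFinP/measurableT_comp.
  - by move=> n x _; rewrite EFinM nnfun_muleindic_ge0.
under [RHS]eq_integral.
  move=> x xD; rewrite EFinM fimfunE -fsumEFin// ge0_mule_fsuml; last first.
    by move=> r; rewrite EFinM nnfun_muleindic_ge0.
  over.
rewrite [RHS]ge0_integral_fsum//; last 2 first.
  - move=> r; apply: emeasurable_funM; last exact/measurable_EFinP/measurable_funTS.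
    by apply/measurable_EFinP/measurable_funTS; exact: measurable_funM.
  - move=> n x _; apply: mule_ge0; [exact: nnfun_muleindic_ge0|by rewrite lee_fin].
apply: eq_fsbigr => r _.
have mfr : measurable (f @^-1` [set r]) by exact: measurable_funPTI.
transitivity (r%:E * \int[mu]_(x in D `&` f @^-1` [set r]) (rho x)%:E)%E.
  rewrite integralZl_indic_nnsfun// integral_indic// setIT.
  by congr (_ * _)%E; exact: P_rho.
rewrite integral_mkcondr.
(* A negative [r] is not a value of [f], so both sides vanish; a nonnegative one can be taken out of
   the integral. *)
have [r0|r0] := leP 0 r; last first.
  rewrite preimage_nnfun0// integral0_eq ?mule0 => [|x _]; last first.
    by rewrite patchE in_set0.
  by rewrite integral0_eq// => x _; rewrite indic0 mulr0 mul0e.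
rewrite -ge0_integralZl//.
- by apply: eq_integral => x _; rewrite patchE indicE; case: ifP => _;
  rewrite ?mulr1 ?mulr0 ?mule0 ?mul0e.
- apply/(measurable_restrict _ mfr mD); apply: measurable_funS (measurableT) _ _ => //.
  exact/measurable_EFinP.
- by move=> x _; rewrite patchE; case: ifP => // _; rewrite lee_fin.
Qed.

(** Monotone convergence on both sides along simple functions increasing to [f]; multiplying by
    [rho], which is nonnegative, keeps the sequence increasing. *)
Lemma ge0_integral_density (f : T -> \bar R) :
  measurable_fun setT f -> (forall x, 0 <= f x)%E ->
  (\int[P]_x f x = \int[mu]_(x in D) (f x * (rho x)%:E))%E.
Proof.
move=> mf f0.
pose f_ := nnsfun_approx measurableT mf.
have rho0 x : (0 <= (rho x)%:E)%E by rewrite lee_fin.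
transitivity (lim (\int[P]_x (f_ n x)%:E @[n --> \oo])%E).
  rewrite -monotone_convergence//=.
  - apply: eq_integral => ? /[!inE] xD; apply/esym/cvg_lim => //=.
    exact: cvg_nnsfun_approx.
  - by move=> n; exact/measurable_EFinP/measurable_funTS.
  - by move=> n ? _; rewrite lee_fin.
  - by move=> ? _ ? ? mn; rewrite lee_fin; exact/lefP/nd_nnsfun_approx.
under eq_fun do rewrite integral_density_nnsfun.
rewrite -monotone_convergence//=.
- apply: eq_integral => x _; apply/cvg_lim => //=.
  under eq_fun do rewrite EFinM.
  apply: cvgeZr => //; exact: cvg_nnsfun_approx.
- move=> n; apply/measurable_EFinP/measurable_funM; last exact: measurable_funTS.
  exact: measurable_funTS.
- by move=> n x _; rewrite lee_fin mulr_ge0.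
- move=> x _ m n mn; rewrite lee_fin ler_wpM2r//.
  exact/lefP/nd_nnsfun_approx.
Qed.

Lemma integrable_density (f : T -> \bar R) : measurable_fun setT f ->
  mu.-integrable D (fun x => f x * (rho x)%:E)%E -> P.-integrable setT f.
Proof.
move=> mf /integrableP[_ intf]; apply/integrableP; split => //.
rewrite ge0_integral_density//; last exact: measurableT_comp.
under eq_integral do rewrite -[(rho _)%:E]gee0_abs ?lee_fin// -abseM.
exact: intf.
Qed.

(** As [rho] is nonnegative, multiplication by it commutes with taking positive and negative
    parts. *)
Lemma integral_density (f : T -> \bar R) : measurable_fun setT f ->
  (\int[P]_x f x = \int[mu]_(x in D) (f x * (rho x)%:E))%E.
Proof.
move=> mf; rewrite integralE [RHS]integralE.
rewrite !ge0_integral_density//;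
  [|exact: measurable_funeneg|exact: measurable_funepos].
congr (_ - _)%E; apply: eq_integral => x _.
  by rewrite !funeposE maxe_pMl ?lee_fin// mul0e.
by rewrite !funenegE maxe_pMl ?lee_fin// mul0e mulNe.
Qed.

End density.

(** * Linear combinations of integrable functions *)

Section has_integral.
Context d (T : measurableType d) (R : realType).
Variables (mu : {measure set T -> \bar R}) (D : set T).
Hypothesis mD : measurable D.

(** Bundling integrability with a real value lets one linearity step carry both. *)
Definition has_integral (f : T -> R) (a : R) : Prop :=
  mu.-integrable D (EFin \o f) /\ (\int[mu]_(x in D) (f x)%:E = a%:E)%E.

Lemma has_integralD f g a b : has_integral f a -> has_integral g b ->
  has_integral (fun x => f x + g x) (a + b).
Proof.
move=> [fi fa] [gi gb]; split; first exact: (integrableD mD fi gi).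
by rewrite EFinD -fa -gb -integralD.
Qed.

Lemma has_integralZ k f a : has_integral f a ->
  has_integral (fun x => k * f x) (k * a).
Proof.
move=> [fi fa]; split; first exact: (integrableZl mD k fi).
by rewrite EFinM -fa -integralZl.
Qed.

Lemma has_integral_fine f : mu.-integrable D (EFin \o f) ->
  has_integral f (fine (\int[mu]_(x in D) (f x)%:E)%E).
Proof. by move=> fi; split => //; rewrite fineK//; exact: integrable_fin_num. Qed.

Lemma eq_has_integral f g a : f =1 g -> has_integral f a -> has_integral g a.
Proof. by move=> /funext ->. Qed.

End has_integral.

(** * The rule multiplied by the density *)

Section quadrature_functions.
Context (R : realType).
Local Notation mu2 := (lebesgue2 R).
Local Notation T := (@triangle R).
Local Notation sqrt3 := (Num.sqrt 3 : R).
Implicit Types (p : plane R) (f h : plane R -> R).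

Lemma measurable_sqnorm : measurable_fun setT (@sqnorm R).
Proof.
apply: (@measurable_funD _ _ _ _ (fun p : plane R => p.1 ^+ 2)
  (fun p : plane R => p.2 ^+ 2)).
  exact: (measurable_funX _ measurable_fst).
exact: (measurable_funX _ measurable_snd).
Qed.

Lemma measurable_triangle_density : measurable_fun setT (@triangle_density R).
Proof.
rewrite (_ : @triangle_density R = fun p => 16 / (3 * sqrt3) * sqnorm p).
  exact: (measurable_funM (measurable_cst _) measurable_sqnorm).
by apply/funext => p; rewrite /triangle_density mulrAC.
Qed.

Lemma triangle_density_ge0 p : 0 <= triangle_density p.
Proof.
by rewrite divr_ge0// mulr_ge0// ?sqnorm_ge0// ltW// sqrt3_gt0.
Qed.

Lemma w1E p : w1 p = sqrt3 / 16 * (sqnorm p)^-1.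
Proof. by rewrite /w1 invfM mulrA. Qed.

Lemma measurable_w1 : measurable_fun setT (@w1 R).
Proof.
(* The power with exponent -1 agrees with the inverse at 0 too, where both are 0, and is known to be
   measurable. *)
rewrite (_ : @w1 R = fun p => sqrt3 / 16 * (sqnorm p `^ (-1))).
  apply: (measurable_funM (measurable_cst _)).
  exact: (measurableT_comp (measurable_powR (-1)) measurable_sqnorm).
by apply/funext => p; rewrite powR_inv1 ?sqnorm_ge0// w1E.
Qed.

Lemma w1_density p : p <> (0, 0) -> w1 p * triangle_density p = 3^-1.
Proof.
move=> p0; have q0 : sqnorm p != 0 by apply/eqP => /sqnorm_eq0.
rewrite w1E /triangle_density; have s0 := sqrt3_gt0 R.
by field; rewrite q0 gt_eqF.
Qed.

(** The identity persists at the origin: the density vanishes there, and the three nodes coincide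
    with the origin, so that their mean cancels [- f (0, 0)]. *)
Lemma four_point_rule_density f p : four_point_rule p f * triangle_density p =
  3^-1 * (f p + f (rot120 p) + f (rot120 (rot120 p))) + - f (0, 0)
  + 3 * sqrt3 / 4 * f (0, 0) * triangle_density p.
Proof.
rewrite /four_point_rule mulrDl; congr (_ + _).
have [->|/eqP p0] := eqVneq p (0, 0).
  rewrite !rot120_0 /triangle_density /sqnorm/= expr0n/= addr0 mulr0 mul0r mulr0.
  by field.
by rewrite mulrAC w1_density//; field.
Qed.

Lemma measurable_four_point_rule f : measurable_fun setT f ->
  measurable_fun setT (fun p => four_point_rule p f).
Proof.
move=> mf; have mR := @measurable_rot120 R.
have mfR := measurableT_comp mf mR.
have mfRR := measurableT_comp mfR mR.
apply: (measurable_funD _ (measurable_cst _)).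
apply: (measurable_funM measurable_w1).
apply: (measurable_funB _ (measurable_cst _)).
exact: (measurable_funD (measurable_funD mf mfR) mfRR).
Qed.

Lemma has_integral_rot120 f a : has_integral mu2 T f a ->
  has_integral mu2 T (fun p => f (rot120 p)) a.
Proof.
have mT := @measurable_triangle R; have mp := @lebesgue2_rot120 R.
move=> [fi fa]; split.
  rewrite -preimage_rot120_triangle.
  exact: (integrable_measure_preserving (phi := @rot120 R) mp mT fi).
rewrite -fa -[in LHS]preimage_rot120_triangle.
rewrite (integral_measure_preserving (f := EFin \o f) mp mT)//.
exact: measurable_int fi.
Qed.

Lemma has_integral_four_point_rule f a :
  has_integral mu2 T (@triangle_density R) 1 -> has_integral mu2 T f a ->
  has_integral mu2 T (fun p => four_point_rule p f * triangle_density p) a.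
Proof.
move=> rho1 fa; have mT := @measurable_triangle R.
have fRa := has_integral_rot120 fa; have fRRa := has_integral_rot120 fRa.
have cst1 : has_integral mu2 T (fun=> - f (0, 0)) (- f (0, 0) * (3 * sqrt3 / 4)).
  split; last by rewrite integral_cst// area_triangle.
  apply: measurable_bounded_integrable => //.
    by rewrite area_triangle ltry.
  by exists `|f (0, 0)|; split => // M + x _ /=; rewrite normrN => /ltW.
apply: (eq_has_integral (fun p => esym (four_point_rule_density f p))).
(* The second term is [- f (0, 0)] times the area; it cancels the third, where the factor 1 is the
   total mass of the density. *)
rewrite (_ : a = 3^-1 * (a + a + a) + - f (0, 0) * (3 * sqrt3 / 4)
  + 3 * sqrt3 / 4 * f (0, 0) * 1); last by field.
apply: (has_integralD mT); last exact: (has_integralZ mT).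
apply: (has_integralD mT) => //; apply: (has_integralZ mT).
by do 2 apply: (has_integralD mT) => //.
Qed.

End quadrature_functions.

(** * Borel representatives and unbiasedness *)

Section quadrature_rule.
Context (R : realType).
Local Notation mu2 := (lebesgue2 R).
Local Notation T := (@triangle R).
Local Notation sqrt3 := (Num.sqrt 3 : R).
Implicit Types (p : plane R) (f h : plane R -> R).

Lemma measurable_origin : measurable [set (0, 0) : plane R].
Proof.
rewrite (_ : [set (0, 0)] = [set 0] `*` [set 0]); first exact: measurableX.
by apply/seteqP; split=> -[x y] /=; [case=> -> ->|case=> -> ->].
Qed.

Lemma lebesgue2_origin : mu2 [set (0, 0)] = 0%E.
Proof.
rewrite (_ : [set (0, 0)] = [set 0] `*` [set 0]); last first.
  by apply/seteqP; split=> -[x y] /=; [case=> -> ->|case=> -> ->].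
rewrite /lebesgue2/= product_measure1E//.
by rewrite [X in (X * _)%E]lebesgue_measure_set1 mul0e.
Qed.

(* The value at the origin must be kept although the origin is negligible,
   since it is a node of the rule. *)
Lemma borel_version f : completed_integrable mu2 T (EFin \o f) ->
  exists h N a, [/\ measurable_fun setT h, h (0, 0) = f (0, 0),
    measurable N, mu2 N = 0%E & forall p, T p -> ~ N p -> h p = f p] /\
    has_integral mu2 T h a /\ (\int[mu2]_(p in T) (f p)%:E = a%:E)%E.
Proof.
move=> [g ig fg]; have mT := @measurable_triangle R.
have [N [mN N0 subN]] := fg.
pose I0 : plane R -> R := \1_[set (0, 0)].
have mI0 : measurable_fun setT I0.
  by apply: measurable_indic; exact: measurable_origin.
(* The indicator overrides [g] at the origin by the true value of [f]; [fine] turns infinite values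
   of [g] into 0. *)
pose h p := fine ((g \_ T) p) * (1 - I0 p) + f (0, 0) * I0 p.
have mg : measurable_fun setT (g \_ T).
  by apply/(measurable_restrictT _ mT); exact: measurable_int ig.
have mh : measurable_fun setT h.
  apply: measurable_funD; apply: measurable_funM => //.
    exact: measurableT_comp mg.
  exact: measurable_funB.
have I00 : I0 (0, 0) = 1 by rewrite /I0 indicE mem_set.
have I0N p : p <> (0, 0) -> I0 p = 0.
  by move=> p0; rewrite /I0 indicE memNset.
have hf p : T p -> ~ N p -> h p = f p.
  move=> Tp Np; have [->|/eqP p0] := eqVneq p (0, 0).
    by rewrite /h I00 subrr mulr0 add0r mulr1.
  rewrite /h I0N// subr0 mulr1 mulr0 addr0 patchE mem_set//.
  suff <- : (f p)%:E = g p by [].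
  by apply: contrapT => fgp; apply/Np/subN => /= /(_ Tp).
have ih : mu2.-integrable T (EFin \o h).
  have icst : mu2.-integrable T (EFin \o cst `|f (0, 0)|).
    apply: measurable_bounded_integrable => //.
      by rewrite area_triangle ltry.
    by exists `|f (0, 0)|; split => // M + x _ /=; rewrite normr_id => /ltW.
  (* [h] is dominated by [|g|] plus the constant [|f (0, 0)|], which covers the overridden value. *)
  apply: (le_integrable mT _ _ (integrableD mT (integrable_abse ig) icst)).
    exact/measurable_EFinP/measurable_funTS.
  move=> p Tp /=; rewrite gee0_abs ?adde_ge0// /h patchE mem_set//.
  have [->|/eqP p0] := eqVneq p (0, 0).
    by rewrite I00 subrr mulr0 add0r mulr1 leeDr.
  rewrite I0N// subr0 mulr1 mulr0 addr0; rewrite (le_trans _ (leeDl _ _))//.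
  by case: (g p) => [r| |]//=; rewrite normr0 leey.
exists h, N, (fine (\int[mu2]_(p in T) (h p)%:E)%E); split.
  by split => //; rewrite /h I00 subrr mulr0 add0r mulr1.
split; first exact: has_integral_fine.
rewrite -(has_integral_fine mT ih).2; apply: Defs.integral_ae_eq.
exists N; split => // p /= /not_implyP[Tp fhp]; apply: contrapT => Np.
by apply: fhp; rewrite hf.
Qed.

Context d (Omega : measurableType d) (P : probability Omega R).
Variable X : {RV P >-> plane R}.
Hypothesis hX : random_point_with_density T X (@triangle_density R).

Let XT omega : T (X omega). Proof. exact: hX.1. Qed.

Let distrE (A : set (plane R)) : measurable A -> distribution P X A =
  (\int[mu2]_(p in T `&` A) (triangle_density p)%:E)%E.
Proof. exact: hX.2. Qed.

(** Absolute continuity of the law of [X], which turns Lebesgue null sets into negligible events. *)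
Lemma distribution_null (N : set (plane R)) :
  measurable N -> mu2 N = 0%E -> P (X @^-1` N) = 0%E.
Proof.
move=> mN N0; rewrite -[LHS]/(distribution P X N) distrE//.
have mT := @measurable_triangle R.
have mTN : measurable (T `&` N) by exact: measurableI.
have mrho : measurable_fun (T `&` N) (EFin \o @triangle_density R).
  apply/measurable_EFinP/measurable_funTS; exact: measurable_triangle_density.
apply: (null_set_integral mTN mrho).
by apply: (subset_measure0 mTN mN _ N0) => p [].
Qed.

(** The total mass is 1 because the law of [X] is a probability; the integral of [|x|^2] over the
    triangle is not computed. *)
Lemma has_integral_triangle_density : has_integral mu2 T (@triangle_density R) 1.
Proof.
have mT := @measurable_triangle R.
have rho1 : (\int[mu2]_(p in T) (triangle_density p)%:E = 1)%E.
  by rewrite -[X in integral _ X]setIT -distrE// probability_setT.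
split => //; apply/integrableP; split.
  apply/measurable_EFinP/measurable_funTS; exact: measurable_triangle_density.
under eq_integral do rewrite gee0_abs ?lee_fin ?triangle_density_ge0//.
by rewrite rho1 ltry.
Qed.

Lemma has_integral_comp_density (F : plane R -> R) a : measurable_fun setT F ->
  has_integral mu2 T (fun p => F p * triangle_density p) a ->
  has_integral P setT (F \o X) a.
Proof.
move=> mF [Fi Fa]; have mT := @measurable_triangle R.
have mEF : measurable_fun setT (EFin \o F) by exact/measurable_EFinP.
have iF : (distribution P X).-integrable setT (EFin \o F).
  exact: (integrable_density mT (@measurable_triangle_density R)
    (@triangle_density_ge0 R) distrE mEF Fi).
have iFX : P.-integrable setT (EFin \o F \o X).
  apply/integrableP; split; first exact: measurableT_comp.
  move/integrableP : iF => [_]; rewrite ge0_integral_distribution//.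
  exact: measurableT_comp.
split => //; rewrite -[LHS]/(\int[P]_x ((EFin \o F) \o X) x)%E.
rewrite -integral_distribution// (integral_density mT
  (@measurable_triangle_density R) (@triangle_density_ge0 R) distrE mEF).
exact: Fa.
Qed.

(** The result for a Borel version [h] passes to [f]: the two rules differ only if one of the three
    moving nodes falls into the null set [N], while at the fixed node [h] and [f] agree. *)
Lemma four_point_rule_unbiased :
  unbiased P T (fun omega f => four_point_rule (X omega) f).
Proof.
move=> f /borel_version[h [N [a [[mh h0 mN N0 hf] [ha ->]]]]].
have [qi qa] := has_integral_comp_density (measurable_four_point_rule mh)
  (has_integral_four_point_rule has_integral_triangle_density ha).
(* The positions of [X] for which a moving node meets [N]; this set is null by rotation
   invariance. *)
pose N' := N `|` (@rot120 R @^-1` N) `|` (@rot120 R @^-1` (@rot120 R @^-1` N)).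
have mR := @measurable_rot120 R; have [_ muR] := lebesgue2_rot120 R.
have mN1 := measurable_preimage mR mN; have mN2 := measurable_preimage mR mN1.
have mN' : measurable N' by do 2 apply: measurableU => //.
have N'0 : mu2 N' = 0%E.
  have R0 := muR _ mN; have RR0 := muR _ mN1; rewrite N0 in R0; rewrite R0 in RR0.
  by rewrite (measureU0 (measurableU _ _ mN mN1) mN2 RR0) (measureU0 mN mN1 R0).
have Qae : ae_eq P setT (fun omega => (four_point_rule (X omega) f)%:E)
    (EFin \o ((fun p => four_point_rule p h) \o X)).
  exists (X @^-1` N'); split.
  - exact: measurable_preimage.
  - exact: distribution_null.
  - move=> omega /= /not_implyP[_ Qfh]; apply: contrapT => XN; apply: Qfh.
    have TX := XT omega; have TRX := triangle_rot120 TX.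
    have TRRX := triangle_rot120 TRX.
    rewrite /four_point_rule h0 !hf// => ?; apply: XN; rewrite /N'/=.
    + by right.
    + by left; right.
    + by left; left.
split; first by exists (EFin \o ((fun p => four_point_rule p h) \o X)).
by rewrite unlock (Defs.integral_ae_eq Qae).
Qed.

End quadrature_rule.

(** * Exactness for polynomials of degree at most 2 *)

Section order_two.
Context (R : realType).
Local Notation mu2 := (lebesgue2 R).
Local Notation T := (@triangle R).
Local Notation sqrt3 := (Num.sqrt 3 : R).
Local Notation quadratic := (@Poly2Theory.quadratic R).

(** Summing over the three rotations kills the linear terms, [x y] and [x^2 - y^2]; only the
    constant and the multiple of [x^2 + y^2] survive. *)
Lemma quadratic_rot120 c (p : plane R) :
  quadratic c p + quadratic c (rot120 p) + quadratic c (rot120 (rot120 p))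
    - 3 * quadratic c (0, 0) =
  3 / 2 * (c (inord 3) + c (inord 5)) * sqnorm p.
Proof.
case: p => x y; have s3 := sqr_sqrt3 R.
by rewrite !rot120E /quadratic /sqnorm/=; field: s3.
Qed.

Lemma four_point_rule_quadratic c (p : plane R) : p <> (0, 0) ->
  four_point_rule p (quadratic c) =
  sqrt3 / 16 * (3 / 2 * (c (inord 3) + c (inord 5)))
  + 3 * sqrt3 / 4 * quadratic c (0, 0).
Proof.
move=> p0; have q0 : sqnorm p != 0 by apply/eqP => /sqnorm_eq0.
by rewrite /four_point_rule quadratic_rot120 w1E -mulrA (mulrC (sqnorm p)^-1) mulfK.
Qed.

Lemma measurable_quadratic c :
  measurable_fun setT (quadratic c : plane R -> R).
Proof.
have m1 := @measurable_fst _ _ (measurableTypeR R) (measurableTypeR R).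
have m2 := @measurable_snd _ _ (measurableTypeR R) (measurableTypeR R).
have mcM a (f : plane R -> R) : measurable_fun setT f ->
  measurable_fun setT (fun p => a * f p) by move=> mf; exact: measurable_funM.
have q0 := @measurable_cst _ _ (plane R) R setT (c (inord 0)).
have q1 := mcM (c (inord 1)) _ m1.
have q2 := mcM (c (inord 2)) _ m2.
have q3 := mcM (c (inord 3)) _ (measurable_funX 2 m1).
have q4 := mcM (c (inord 4)) _ (measurable_funM m1 m2).
have q5 := mcM (c (inord 5)) _ (measurable_funX 2 m2).
exact: (measurable_funD (measurable_funD (measurable_funD (measurable_funD
  (measurable_funD q0 q1) q2) q3) q4) q5).
Qed.

Lemma triangle_bounded (p : plane R) : T p -> `|p.1| <= 1 /\ `|p.2| <= 1.
Proof.
case: p => x y /triangleP[/= h1 h2 h3].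
have s0 := sqrt3_gt0 R; have s3 := sqr_sqrt3 R.
(* This crude bound suffices, since [sqrt3 |x| <= 1 - y <= 3 / 2] on the triangle. *)
have s1 : 3 / 2 <= sqrt3 by nra.
by rewrite !ler_norml; split; apply/andP; split; nra.
Qed.

Lemma integrable_quadratic c : mu2.-integrable T (EFin \o quadratic c).
Proof.
apply: measurable_bounded_integrable.
- exact: measurable_triangle.
- by rewrite area_triangle ltry.
- by apply: measurable_funTS; exact: measurable_quadratic.
exists (`|c (inord 0)| + `|c (inord 1)| + `|c (inord 2)| + `|c (inord 3)|
  + `|c (inord 4)| + `|c (inord 5)|); split; first exact: num_real.
move=> M /ltW cM p Tp.
have [x1 y1] := triangle_bounded Tp; apply: le_trans cM.
have sq1 (t : R) : `|t| <= 1 -> `|t ^+ 2| <= 1.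
  by move=> t1; rewrite normrX expr_le1.
have cle i (t : R) : `|t| <= 1 -> `|c i * t| <= `|c i|.
  by move=> t1; rewrite normrM ler_piMr.
have xy1 : `|p.1 * p.2| <= 1 by rewrite normrM mulr_ile1.
do 5 (apply: (le_trans (ler_normD _ _)); apply: lerD;
  last by apply: cle; rewrite ?sq1).
by [].
Qed.

Context d (Omega : measurableType d) (P : probability Omega R).
Variable X : {RV P >-> plane R}.
Hypothesis hX : random_point_with_density T X (@triangle_density R).

Lemma four_point_rule_order :
  has_order P T 2 (fun omega f => four_point_rule (X omega) f).
Proof.
(* The exceptional event is that [X] is the origin; it is the same for all polynomials. *)
exists (X @^-1` [set (0, 0)]); split.
- by apply: measurable_preimage => //; exact: measurable_origin.
- exact: (distribution_null hX (@measurable_origin R) (lebesgue2_origin R)).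
move=> omega /= Nomega; apply: contrapT => X0; apply: Nomega => q.
move=> /Poly2Theory.degree2_quadratic[c qE].
have -> : Poly2.eval q = quadratic c by exact/funext.
have [|_ <-] := four_point_rule_unbiased hX (f := quadratic c).
  by exists (EFin \o quadratic c); [exact: integrable_quadratic|exact: aeW].
rewrite four_point_rule_quadratic// unlock.
(* [k] is the almost sure value of the rule, written as its own expectation to be compared with the
   one given by unbiasedness. *)
set k := _ + _; rewrite (_ : k%:E = \int[P]_omega k%:E)%E; last first.
  by rewrite integral_cst//= [X in (_ * X)%E]probability_setT mule1.
apply: Defs.integral_ae_eq; exists (X @^-1` [set (0, 0)]); split.
- by apply: measurable_preimage => //; exact: measurable_origin.
- exact: (distribution_null hX (@measurable_origin R) (lebesgue2_origin R)).
move=> omega' /= /not_implyP[_]; apply: contra_notP => X'0.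
by rewrite four_point_rule_quadratic.
Qed.

(** * Nodes and weights *)

Definition nodes (j : 'I_4) (p : plane R) : plane R :=
  tnth [tuple p; rot120 p; rot120 (rot120 p); (0, 0)] j.

(** The last weight collects both terms of the rule in [f (0, 0)]. *)
Definition weights (j : 'I_4) (p : plane R) : R :=
  tnth [tuple w1 p; w1 p; w1 p; 3 * sqrt3 / 4 - 3 * w1 p] j.

Lemma four_point_rule_stochastic_quadrature :
  is_stochastic_quadrature P T 4 (fun omega f => four_point_rule (X omega) f).
Proof.
have mR := @measurable_rot120 R.
have mX : measurable_fun setT X by [].
have mw : measurable_fun setT (@w1 R \o X).
  exact: measurableT_comp (@measurable_w1 R) mX.
have mx j : measurable_fun setT (nodes j \o X).
  have mRX := measurableT_comp mR mX; have mRRX := measurableT_comp mR mRX.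
  case: j => [[|[|[|[|//]]]] ?];
    [exact: mX|exact: mRX|exact: mRRX|exact: measurable_cst].
have mws j : measurable_fun setT (weights j \o X).
  case: j => [[|[|[|[|//]]]] ?]; [exact: mw|exact: mw|exact: mw|].
  rewrite -[X in measurable_fun _ X]/
    (fun omega => 3 * sqrt3 / 4 - 3 * w1 (X omega)).
  have m3 := measurable_funM (@measurable_cst _ _ Omega R setT (3 : R)) mw.
  have m4 := @measurable_cst _ _ Omega R setT (3 * sqrt3 / 4 : R).
  exact: (measurable_funB m4 m3).
pose x j : {RV P >-> plane R} :=
  HB.pack (nodes j \o X) (isMeasurableFun.Build _ _ _ _ _ (mx j)).
pose w j : {RV P >-> R} :=
  HB.pack (weights j \o X) (isMeasurableFun.Build _ _ _ _ _ (mws j)).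
exists x, w.
split=> [j omega|omega f] /=.
  have TX := hX.1 omega; have TRX := triangle_rot120 TX.
  have TRRX := triangle_rot120 TRX; have T0 := @triangle0 R.
  by case: j => [[|[|[|[|//]]]] ?]; [exact: TX|exact: TRX|exact: TRRX|exact: T0].
rewrite !big_ord_recl big_ord0 /four_point_rule/nodes/weights !(tnth_nth 0)/=.
by ring.
Qed.

End order_two.

Theorem mainTheorem2 (R : realType) (d : measure_display)
    (Omega : measurableType d) (P : probability Omega R)
    (X : {RV P >-> plane R})
    (hX : random_point_with_density (@triangle R) X (@triangle_density R)) :
  let Q := fun omega f => four_point_rule (X omega) f in
  [/\ is_stochastic_quadrature P (@triangle R) 4 Q,
      has_order P (@triangle R) 2 Q &
      unbiased P (@triangle R) Q].
Proof.
move=> Q; split.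
- exact: four_point_rule_stochastic_quadrature.
- exact: four_point_rule_order.
- exact: four_point_rule_unbiased.
Qed.
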